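(* Let $\mathit{Impl}$ be a microarchitecture with architectural registers $\mathit{Arch}$ and microarchitectural registers $\mu\mathit{Arch}$, let $\mathit{LM}$ be a leakage monitor, $\mathit{Atk}$ an attacker, $\phi$ a retirement predicate over $\mathrm{vars}(\mathit{Impl})$, $b\in\mathbb{N}^+$ a lookahead, and $\mathit{CI}$ a finite set of candidate invariants, i.e. predicates over the stuttering product circuit $\mathit{Impl}\times_\phi\mathit{Impl}$. If the procedure $\textsc{Verify}(\mathit{Impl},\mathit{LM},\mathit{Atk},\phi,b,\mathit{CI})$ returns $\top$, then microarchitectural contract satisfaction holds: $$\mathit{LM}\succeq_{\mathit{Impl}}^{\mu\mathit{Arch},\phi}\mathit{Atk}.$$
   Context: **Circuits.** Let $\mathit{Vals}=\mathbb{N}\cup\{\bot\}$, let $\mathit{Regs}$ be a set of registers and $\mathit{Vars}$ a disjoint set of (wire) variables; identifiers are elements of $\mathit{Regs}\cup\mathit{Vars}$. Expressions are $e ::= n \mid i \mid \ominus e \mid e_1\otimes e_2 \mid \mathbf{if}\ e_1\ \mathbf{th}\ e_2\ \mathbf{el}\ e_3 \mid e_1[e_2:e_3]$, with $n\in\mathit{Vals}$, $i$ an identifier, $\ominus,\otimes$ ranging over fixed unary/binary operators on $\mathit{Vals}$, and $e_1[e_2:e_3]$ a bit-selection operator. A circuit $C$ is a triple $C.A : C.W : C.O$ where $C.A$ is a finite set of assignments $r\leftarrow e$ ($r$ a register), $C.W$ is a finite set of wires $v=e$ ($v$ a variable), and $C.O$ is a finite set of identifiers (outputs). $\mathrm{read}(C)$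 is the set of registers occurring in a right-hand side of an assignment in $C.A$ or a wire in $C.W$; $\mathrm{write}(C)$ is the set of registers on left-hand sides in $C.A$; $\mathrm{wires}(C)$ is the set of variables on left-hand sides in $C.W$; $\mathrm{vars}(C)=\mathrm{read}(C)\cup\mathrm{write}(C)$. It is assumed that $C.O\subseteq \mathrm{vars}(C)\cup\mathrm{wires}(C)$ (for a monitor, this is understood for its composition with the monitored circuit), that each register/variable is on the left-hand side of at most one assignment/wire, and that wires have no cyclic dependencies. **Semantics.** A valuation is a map $\mu:\mathit{Regs}\to\mathit{Vals}$. $\mathrm{states}(C)$ is the set of valuations over $\mathrm{vars}(C)$ (registers outside $\mathrm{vars}(C)$ have value $\bot$). $\mu\sim_V\mu'$ means $\mu(r)=\mu'(r)$ for all $r\in V$. The value $[\![e]\!]_C(\mu)$ of an expression is defined recursively: registers evaluate to $\mu(r)$, a wire variable $v$ evaluates to the value of $e$ where $(v=e)\in C.W$, operators are applied to the values of their arguments, and $\mathbf{if}\ e_1\ \mathbf{th}\ e_2\ \mathbf{el}\ e_3$ is the value of $e_2$ if the value of $e_1$ is $\neq 0$ and that of $e_3$ otherwise. A predicate $\phi$ is an expression, and $C,\mu\models\phi$ iff $[\![\phi]\!]_C(\mu)\neq 0$. $[\![C]\!](\mu)$ is the valuation mapping $r$ to $[\![e]\!]_C(\mu)$ if $(r\leftarrow e)\in C.A$ and to $\mu(r)$ if $r\notin\mathrm{write}(C)$. Put $[\![C]\!](\mu,0)=\mu$, $[\![C]\!](\mu,n+1)=[\![C]\!]([\![C]\!](\mu,n))$.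 The infinite trace $[\![C]\!]^\infty(\mu)$ is the sequence $\mu_0\cdot\mu_1\cdots$ where $\mu_i$ records the values (register values, and evaluated wire variables) of all outputs in $C.O$ at state $[\![C]\!](\mu,i)$. The filtered trace $[\![C]\!]^\infty|\phi(\mu)$ is the (finite or infinite) subsequence of those $\mu_i$ with $C,[\![C]\!](\mu,i)\models\phi$. **Temporal logic.** Formulas are built from predicates with boolean operators and $\circ$, $\square^{k}$, $\square$: $C,\mu,i\models\phi$ iff $C,[\![C]\!](\mu,i)\models\phi$ for predicates $\phi$; $C,\mu,i\models\circ\Phi$ iff $C,\mu,i+1\models\Phi$; $C,\mu,i\models\square^{k}\Phi$ iff $C,\mu,i+j\models\Phi$ for all $j<k$; $C,\mu,i\models\square\Phi$ iff $C,\mu,i+j\models\Phi$ for all $j\in\mathbb{N}$. $C,\mu\models\Phi$ means $C,\mu,0\models\Phi$, and $C\models\Phi$ means $C,\mu\models\Phi$ for all $\mu\in\mathrm{states}(C)$. **Microarchitectures and monitors.** An architecture is a circuit $\mathit{ISA}$ with $\mathrm{vars}(\mathit{ISA})=\mathit{ISA}.O=\mathit{Arch}$ and a designated set of initial states $\mathrm{init}(\mathit{ISA})\subseteq\mathrm{states}(\mathit{ISA})$. A microarchitecture is a circuit $\mathit{Impl}$ with $\mathrm{vars}(\mathit{Impl})=\mathit{Impl}.O=\mathit{Arch}\cup\mu\mathit{Arch}$, $\mathit{Arch}\cap\mu\mathit{Arch}=\emptyset$, and a designated set of initial states $\mathrm{init}(\mathit{Impl})\subseteq\mathrm{states}(\mathit{Impl})$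 whose restrictions to $\mathit{Arch}$ lie in $\mathrm{init}(\mathit{ISA})$. A retirement predicate is a predicate over $\mathrm{vars}(\mathit{Impl})$ (indicating when $\mathit{Impl}$ retires instructions; no property of it is assumed here). A circuit $M$ is a monitoring circuit for $C$ if $\mathrm{write}(C)\cap\mathrm{write}(M)=\emptyset$, $\mathrm{wires}(C)\cap\mathrm{wires}(M)=\emptyset$, $\mathrm{vars}(C)\cap\mathrm{write}(M)=\emptyset$; it is combinatorial if $\mathrm{read}(M)\subseteq\mathrm{vars}(C)$, and it then has no state of its own ($M.A=\emptyset$). The composition is $M[C]=(C.A\cup M.A):(C.W\cup M.W):M.O$. A leakage monitor $\mathit{LM}$ is a combinatorial monitoring circuit for $\mathit{ISA}$ that is also a combinatorial monitoring circuit for $\mathit{Impl}$; an attacker $\mathit{Atk}$ is a combinatorial monitoring circuit for $\mathit{Impl}$. **Microarchitectural contract satisfaction.** $\mathit{LM}\succeq_{\mathit{Impl}}^{\mu\mathit{Arch},\phi}\mathit{Atk}$ means: for all $\mu,\mu'\in\mathrm{init}(\mathit{Impl})$ with $\mu\sim_{\mu\mathit{Arch}}\mu'$, if $[\![\mathit{LM}[\mathit{Impl}]]\!]^\infty|\phi(\mu)=[\![\mathit{LM}[\mathit{Impl}]]\!]^\infty|\phi(\mu')$ then $[\![\mathit{Atk}[\mathit{Impl}]]\!]^\infty(\mu)=[\![\mathit{Atk}[\mathit{Impl}]]\!]^\infty(\mu')$. **Stuttering product circuit.** For a circuit $C$ and $k\in\{1,2\}$, write $x^k,v^k,e^k$ for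 the $k$-th (disjoint) copies of registers, variables, expressions ($e^k$ replaces every identifier in $e$ by its $k$-th copy). $C\times_\phi C$ has, for each assignment $x\leftarrow e$ of $C$, the assignments $x^1\leftarrow \mathbf{if}\ \phi^1\wedge\neg\phi^2\ \mathbf{th}\ x^1\ \mathbf{el}\ e^1$ and $x^2\leftarrow \mathbf{if}\ \phi^2\wedge\neg\phi^1\ \mathbf{th}\ x^2\ \mathbf{el}\ e^2$; for each wire $v=e$ of $C$ the wires $v^1=e^1$, $v^2=e^2$; and for each output $o$ the outputs $o^1,o^2$. **Predicates used.** Over $\mathit{Impl}\times_\phi\mathit{Impl}$: $\psi_{\mathit{init}}^{k}$ ($k=1,2$) holds iff the $k$-th component of the state is in $\mathrm{init}(\mathit{Impl})$; $\psi_{\mathit{equiv}}^{\mu\mathit{Arch}}=\bigwedge_{x\in\mu\mathit{Arch}}x^1=x^2$; for a monitor $M$, $\psi_{\mathit{equiv}}^{M}=\bigwedge_{o\in M.O}o^1=o^2$, where $o^k$ denotes the value of output $o$ of $M[\mathit{Impl}]$ in the $k$-th component of the state. **Procedures.** $\bigwedge S$ is the conjunction of the formulas in $S$. $\textsc{Verify}(\mathit{Impl},\mathit{LM},\mathit{Atk},\phi,b,\mathit{CI})$: set $\Phi_{\mathit{initial}}:=\psi_{\mathit{init}}^{1}\wedge\psi_{\mathit{init}}^{2}\wedge\psi_{\mathit{equiv}}^{\mu\mathit{Arch}}$ and $\Phi_{\mathit{ctr\text{-}equiv}}:=(\phi^1\wedge\phi^2\to\psi_{\mathit{equiv}}^{\mathit{LM}})$;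 set $\mathit{LI}:=\textsc{LearnInv}(\mathit{Impl}\times_\phi\mathit{Impl},\Phi_{\mathit{initial}},\Phi_{\mathit{ctr\text{-}equiv}},b,\mathit{CI})$; return the truth value of $\mathit{Impl}\times_\phi\mathit{Impl}\models \bigwedge\mathit{LI}\to\big(\psi_{\mathit{equiv}}^{\mathit{Atk}}\wedge(\phi^1\leftrightarrow\phi^2)\big)$. $\textsc{LearnInv}(C,\Phi_{\mathit{initial}},\Phi_{\mathit{assumption}},b,\mathit{CI})$: (Base case) Repeat: let $\Psi_{\mathit{base}}:=(\Phi_{\mathit{initial}}\wedge\square^{b}\Phi_{\mathit{assumption}})\to\bigwedge\mathit{CI}$; if $C\models\Psi_{\mathit{base}}$ leave this loop; otherwise choose any counterexample $\mu$ (i.e. $C,\mu\not\models\Psi_{\mathit{base}}$) and set $\mathit{CI}:=\{\psi\in\mathit{CI}\mid C,\mu\models\psi\}$. (Induction step) Then repeat: let $\Psi_{\mathit{inductive}}:=(\bigwedge\mathit{CI}\wedge\square^{b}\Phi_{\mathit{assumption}})\to\circ\bigwedge\mathit{CI}$; if $C\models\Psi_{\mathit{inductive}}$ return $\mathit{CI}$; otherwise choose any counterexample $\mu$ and set $\mathit{CI}:=\{\psi\in\mathit{CI}\mid C,\mu\models\circ\psi\}$. *)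

(* Defs.v *)
From HB Require Import structures.
From mathcomp Require Import all_boot finmap boolp classical_sets.

Set Implicit Arguments.
Unset Strict Implicit.
Unset Printing Implicit Defensive.

Local Open Scope fset_scope.

(* [None] is the undefined value. *)
Notation vals := (option nat).

(* The fixed operators of the expression language, with arbitrary
   interpretations; [bitsel v1 v2 v3] interprets e1[e2:e3]. *)
Record operators := Operators {
  unop : Type;
  binop : Type;
  unop_sem : unop -> vals -> vals;
  binop_sem : binop -> vals -> vals -> vals;
  bitsel : vals -> vals -> vals -> vals }.

(* Registers and wire variables live in two separate types, so that they are
   disjoint by construction. *)
Definition ident (R V : choiceType) : choiceType := (R + V)%type.

Inductive expr (S : operators) (R V : choiceType) :=
| Const of vals
| Id of ident R V
| Un of unop S & expr S R V
| Bin of binop S & expr S R V & expr S R V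
| If of expr S R V & expr S R V & expr S R V
| Sel of expr S R V & expr S R V & expr S R V.

Arguments Const {S R V}.
Arguments Id {S R V}.

(* Needed only to form finite sets of assignments, wires and predicates. *)
HB.instance Definition _ (S : operators) (R V : choiceType) :=
  gen_eqMixin (expr S R V).
HB.instance Definition _ (S : operators) (R V : choiceType) :=
  gen_choiceMixin (expr S R V).

Fixpoint eregs S R V (e : expr S R V) : {fset R} :=
  match e with
  | Const _ => fset0
  | Id (inl r) => [fset r]
  | Id (inr _) => fset0
  | Un _ e1 => eregs e1
  | Bin _ e1 e2 => eregs e1 `|` eregs e2
  | If e1 e2 e3 | Sel e1 e2 e3 => eregs e1 `|` eregs e2 `|` eregs e3
  end.

Fixpoint evars S R V (e : expr S R V) : {fset V} :=
  match e with
  | Const _ => fset0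
  | Id (inl _) => fset0
  | Id (inr v) => [fset v]
  | Un _ e1 => evars e1
  | Bin _ e1 e2 => evars e1 `|` evars e2
  | If e1 e2 e3 | Sel e1 e2 e3 => evars e1 `|` evars e2 `|` evars e3
  end.

Record circuit (S : operators) (R V : choiceType) := Circuit {
  assigns : {fset R * expr S R V};
  wiredefs : {fset V * expr S R V};
  outputs : {fset ident R V} }.

Section Circuits.
Variables (S : operators) (R V : choiceType).
Implicit Types (C M : circuit S R V) (e : expr S R V).

Definition rhs C : {fset expr S R V} :=
  [fset a.2 | a in assigns C] `|` [fset w.2 | w in wiredefs C].

Definition read C : {fset R} := \bigcup_(e <- rhs C) eregs e.
Definition write C : {fset R} := [fset a.1 | a in assigns C].
Definition wires C : {fset V} := [fset w.1 | w in wiredefs C].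
Definition vars C : {fset R} := read C `|` write C.

Definition idents C : {fset ident R V} :=
  [fset inl r | r in vars C] `|` [fset inr v | v in wires C].

(* The right-hand side bound to [x]; unambiguous when [functional D]. *)
Definition lookup (K : choiceType) (D : {fset K * expr S R V}) (x : K) :
    option (expr S R V) :=
  ohead [seq d.2 | d <- D & d.1 == x].

Definition functional (K : choiceType) (D : {fset K * expr S R V}) :=
  forall x e1 e2, (x, e1) \in D -> (x, e2) \in D -> e1 = e2.

Definition wire_dep C : rel V :=
  fun v w => [exists d : wiredefs C,
    ((val d).1 == v) && (w \in evars (val d).2)].

(* The last condition says that every wire variable that is used is also
   defined, so that all right-hand sides have a value. *)
Definition well_formed C :=
  [/\ functional (assigns C), functional (wiredefs C),
      forall p, cycle (wire_dep C) p -> p = [::],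
      outputs C `<=` idents C
    & forall e, e \in rhs C -> evars e `<=` wires C].

Definition compose M C : circuit S R V :=
  Circuit (assigns C `|` assigns M) (wiredefs C `|` wiredefs M) (outputs M).

Definition monitoring C M :=
  [/\ [disjoint write C & write M], [disjoint wires C & wires M],
      [disjoint vars C & write M] & well_formed (compose M C)].

Definition combinatorial C M :=
  [/\ monitoring C M, read M `<=` vars C & assigns M = fset0].

End Circuits.

Definition valuation (R : choiceType) := R -> vals.

Section Semantics.
Variables (S : operators) (R V : choiceType).
Implicit Types (C : circuit S R V) (e : expr S R V) (mu : valuation R).

Definition truthy (v : vals) : bool := v != Some 0.

Fixpoint eval_env (rho : V -> vals) mu e : vals :=
  match e with
  | Const n => n
  | Id (inl r) => mu r
  | Id (inr v) => rho v
  | Un o e1 => unop_sem o (eval_env rho mu e1)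
  | Bin o e1 e2 => binop_sem o (eval_env rho mu e1) (eval_env rho mu e2)
  | If e1 e2 e3 =>
      if truthy (eval_env rho mu e1) then eval_env rho mu e2
      else eval_env rho mu e3
  | Sel e1 e2 e3 =>
      bitsel S (eval_env rho mu e1) (eval_env rho mu e2) (eval_env rho mu e3)
  end.

(* Wires are unfolded [n] times. When wires are acyclic, a chain of
   dependencies visits each wire at most once, so unfolding as many times as
   there are wires is enough: see [eval_wire]. *)
Fixpoint wire_val C mu n (v : V) : vals :=
  if n isn't n'.+1 then None else
  if lookup (wiredefs C) v is Some e then eval_env (wire_val C mu n') mu e
  else None.

Definition eval C mu e : vals :=
  eval_env (wire_val C mu #|` wires C|) mu e.

Definition holds C mu e : bool := truthy (eval C mu e).

Definition step C mu : valuation R :=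
  fun r => if lookup (assigns C) r is Some e then eval C mu e else mu r.

Definition run C mu n : valuation R := iter n (step C) mu.

Definition states C : set (valuation R) :=
  [set mu | forall r, r \notin vars C -> mu r = None]%classic.

Definition equiv_on (X : {fset R}) mu mu' := {in X, mu =1 mu'}.

Definition restrict (X : {fset R}) mu : valuation R :=
  fun r => if r \in X then mu r else None.

Definition observe C mu : {fmap ident R V -> vals} :=
  [fmap o : outputs C => eval C mu (Id (val o))].

Definition trace C mu : nat -> {fmap ident R V -> vals} :=
  fun i => observe C (run C mu i).

(* Step [i] is the one with (zero-based) rank [n] among those satisfying
   [phi]. *)
Definition nth_hit C phi mu n i : bool :=
  holds C (run C mu i) phi
  && (count (fun j => holds C (run C mu j) phi) (iota 0 i) == n).

(* A finite or infinite sequence, as the map sending [n] to its entry of rank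
   [n], and to [None] past its end. *)
Definition filtered_trace C phi mu : nat -> option {fmap ident R V -> vals} :=
  fun n => match pselect (exists i, nth_hit C phi mu n i) with
           | left ex_i => Some (trace C mu (ex_minn ex_i))
           | right _ => None
           end.

End Semantics.

(* Besides expressions, atoms may be arbitrary state predicates, as a set of
   initial states need not be definable by an expression. *)
Inductive formula (S : operators) (R V : choiceType) :=
| FTrue
| FPred of expr S R V
| FState of (valuation R -> Prop)
| FNot of formula S R V
| FAnd of formula S R V & formula S R V
| FOr of formula S R V & formula S R V
| FImp of formula S R V & formula S R V
| FIff of formula S R V & formula S R V
| FNext of formula S R V
| FBoxk of nat & formula S R V
| FBox of formula S R V.

Arguments FTrue {S R V}.
Arguments FState {S R V}.

Fixpoint sat_at S R V (C : circuit S R V) (mu : valuation R) (i : nat)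
    (F : formula S R V) : Prop :=
  match F with
  | FTrue => True
  | FPred e => holds C (run C mu i) e
  | FState P => P (run C mu i)
  | FNot F1 => ~ sat_at C mu i F1
  | FAnd F1 F2 => sat_at C mu i F1 /\ sat_at C mu i F2
  | FOr F1 F2 => sat_at C mu i F1 \/ sat_at C mu i F2
  | FImp F1 F2 => sat_at C mu i F1 -> sat_at C mu i F2
  | FIff F1 F2 => sat_at C mu i F1 <-> sat_at C mu i F2
  | FNext F1 => sat_at C mu i.+1 F1
  | FBoxk k F1 => forall j, j < k -> sat_at C mu (i + j) F1
  | FBox F1 => forall j, sat_at C mu (i + j) F1
  end.

Definition sat S R V (C : circuit S R V) mu (F : formula S R V) : Prop :=
  sat_at C mu 0 F.

Definition valid S R V (C : circuit S R V) (F : formula S R V) : Prop :=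
  forall mu, states C mu -> sat C mu F.

Definition conj_preds S R V (CI : {fset expr S R V}) : formula S R V :=
  \big[@FAnd S R V/FTrue]_(psi <- CI) FPred psi.

Record architecture (S : operators) (R V : choiceType) := Architecture {
  isa_circuit :> circuit S R V;
  isa_init : set (valuation R);
  isa_well_formed : well_formed isa_circuit;
  isa_outputs : outputs isa_circuit = [fset inl r | r in vars isa_circuit];
  isa_init_states : (isa_init `<=` states isa_circuit)%classic }.

Definition arch S R V (ISA : architecture S R V) : {fset R} := vars ISA.

Record microarchitecture S R V (ISA : architecture S R V) :=
  Microarchitecture {
  impl_circuit :> circuit S R V;
  uarch : {fset R};
  impl_init : set (valuation R);
  impl_well_formed : well_formed impl_circuit;
  impl_vars : vars impl_circuit = arch ISA `|` uarch;
  impl_outputs : outputs impl_circuit = [fset inl r | r in vars impl_circuit];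
  impl_disjoint : [disjoint arch ISA & uarch];
  impl_init_states : (impl_init `<=` states impl_circuit)%classic;
  impl_init_arch : forall mu, impl_init mu ->
    isa_init ISA (restrict (arch ISA) mu) }.

Definition leakage_monitor S R V (ISA : architecture S R V)
    (Impl : microarchitecture ISA) (LM : circuit S R V) :=
  combinatorial ISA LM /\ combinatorial Impl LM.

Definition attacker S R V (ISA : architecture S R V)
    (Impl : microarchitecture ISA) (Atk : circuit S R V) :=
  combinatorial Impl Atk.

Definition retirement_predicate S R V (ISA : architecture S R V)
    (Impl : microarchitecture ISA) (phi : expr S R V) :=
  (eregs phi `<=` vars Impl) /\ evars phi = fset0.

Definition contract_sat S R V (ISA : architecture S R V)
    (Impl : microarchitecture ISA) (phi : expr S R V)
    (LM Atk : circuit S R V) : Prop :=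
  forall mu mu', impl_init Impl mu -> impl_init Impl mu' ->
    equiv_on (uarch Impl) mu mu' ->
    filtered_trace (compose LM Impl) phi mu
      = filtered_trace (compose LM Impl) phi mu' ->
    trace (compose Atk Impl) mu = trace (compose Atk Impl) mu'.

(* The two copies are indexed by [bool]: [false] is the first one and [true]
   the second one. *)
Fixpoint copy S R V (k : bool) (e : expr S R V) :
    expr S (R * bool)%type (V * bool)%type :=
  match e with
  | Const n => Const n
  | Id (inl r) => Id (inl (r, k))
  | Id (inr v) => Id (inr (v, k))
  | Un o e1 => Un o (copy k e1)
  | Bin o e1 e2 => Bin o (copy k e1) (copy k e2)
  | If e1 e2 e3 => If (copy k e1) (copy k e2) (copy k e3)
  | Sel e1 e2 e3 => Sel (copy k e1) (copy k e2) (copy k e3)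
  end.

Definition copy_id (R V : choiceType) (k : bool) (i : ident R V) :
    ident (R * bool)%type (V * bool)%type :=
  match i with inl r => inl (r, k) | inr v => inr (v, k) end.

(* The conjunction and negation of predicates, encoded with conditionals since
   the operators are arbitrary. *)
Definition ENot S R V (e : expr S R V) : expr S R V :=
  If e (Const (Some 0)) (Const (Some 1)).
Definition EAnd S R V (e1 e2 : expr S R V) : expr S R V :=
  If e1 e2 (Const (Some 0)).

Definition stutter_product S R V (phi : expr S R V) (C : circuit S R V) :
    circuit S (R * bool)%type (V * bool)%type :=
  Circuit
    [fset ((a.1, k), If (EAnd (copy k phi) (ENot (copy (~~ k) phi)))
                        (Id (inl (a.1, k))) (copy k a.2))
      | a in assigns C, k in [fset false; true]]
    [fset ((w.1, k), copy k w.2) | w in wiredefs C, k in [fset false; true]]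
    [fset copy_id k o | o in outputs C, k in [fset false; true]].

Definition component (R : choiceType) (k : bool)
    (mu : valuation (R * bool)%type) : valuation R :=
  fun r => mu (r, k).

Section Procedures.
Variables (S : operators) (R V : choiceType).

Definition predicate_over (C : circuit S R V) (psi : expr S R V) :=
  (eregs psi `<=` vars C) /\ (evars psi `<=` wires C).

Section LearnInv.
Variables (C : circuit S R V) (Finitial Fassumption : formula S R V) (b : nat).

Definition Psi_base (CI : {fset expr S R V}) : formula S R V :=
  FImp (FAnd Finitial (FBoxk b Fassumption)) (conj_preds CI).

Definition Psi_inductive (CI : {fset expr S R V}) : formula S R V :=
  FImp (FAnd (conj_preds CI) (FBoxk b Fassumption)) (FNext (conj_preds CI)).

(* [base_loop CI CI'] (resp. [inductive_loop CI CI']): some execution of the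
   loop started with [CI], for some choice of the counterexamples, ends
   with [CI']. *)
Inductive base_loop : {fset expr S R V} -> {fset expr S R V} -> Prop :=
| base_exit CI : valid C (Psi_base CI) -> base_loop CI CI
| base_refine CI CI' mu :
    states C mu -> ~ sat C mu (Psi_base CI) ->
    base_loop [fset psi in CI | `[< sat C mu (FPred psi) >]] CI' ->
    base_loop CI CI'.

Inductive inductive_loop : {fset expr S R V} -> {fset expr S R V} -> Prop :=
| inductive_exit CI : valid C (Psi_inductive CI) -> inductive_loop CI CI
| inductive_refine CI CI' mu :
    states C mu -> ~ sat C mu (Psi_inductive CI) ->
    inductive_loop [fset psi in CI | `[< sat C mu (FNext (FPred psi)) >]] CI' ->
    inductive_loop CI CI'.

Definition learn_inv (CI LI : {fset expr S R V}) : Prop :=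
  exists2 CI', base_loop CI CI' & inductive_loop CI' LI.

End LearnInv.
End Procedures.

Section Verify.
Variables (S : operators) (R V : choiceType) (ISA : architecture S R V) (Impl : microarchitecture ISA).

Notation pformula := (formula S (R * bool)%type (V * bool)%type).

Definition psi_init (k : bool) : pformula :=
  FState (fun mu => impl_init Impl (component k mu)).

Definition psi_equiv_regs (X : {fset R}) : pformula :=
  \big[@FAnd _ _ _/FTrue]_(x <- X)
    FState (fun mu => mu (x, false) = mu (x, true)).

Definition psi_equiv_monitor (M : circuit S R V) : pformula :=
  \big[@FAnd _ _ _/FTrue]_(o <- outputs M)
    FState (fun mu => eval (compose M Impl) (component false mu) (Id o)
                    = eval (compose M Impl) (component true mu) (Id o)).

Definition Phi_initial : pformula :=
  FAnd (psi_init false) (FAnd (psi_init true) (psi_equiv_regs (uarch Impl))).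

Definition Phi_ctr_equiv (LM : circuit S R V) (phi : expr S R V) : pformula :=
  FImp (FAnd (FPred (copy false phi)) (FPred (copy true phi)))
       (psi_equiv_monitor LM).

(* Some execution of the procedure returns [res]. *)
Definition verify (LM Atk : circuit S R V) (phi : expr S R V) (b : nat)
    (CI : {fset expr S (R * bool)%type (V * bool)%type}) (res : bool) : Prop :=
  exists2 LI,
    learn_inv (stutter_product phi Impl) Phi_initial (Phi_ctr_equiv LM phi)
      b CI LI
  & (res <-> valid (stutter_product phi Impl)
       (FImp (conj_preds LI)
             (FAnd (psi_equiv_monitor Atk)
                   (FIff (FPred (copy false phi)) (FPred (copy true phi)))))).

End Verify.

Section EvalWire.
Variables (S : operators) (R V : choiceType) (C : circuit S R V).
Hypothesis wfC : well_formed C.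

Lemma lookup_mem (K : choiceType) (D : {fset K * expr S R V}) x e :
  lookup D x = Some e -> (x, e) \in D.
Proof.
rewrite /lookup; case E: [seq d <- D | d.1 == x] => [//|[y f] s] /= [<-].
have: (y, f) \in [seq d <- D | d.1 == x] by rewrite E mem_head.
by rewrite mem_filter /= => /andP[/eqP <-].
Qed.

Lemma mem_lookup (K : choiceType) (D : {fset K * expr S R V}) x e :
  functional D -> (x, e) \in D -> lookup D x = Some e.
Proof.
move=> fD xeD; case E: (lookup D x) => [f|].
  by congr Some; exact: fD (lookup_mem E) xeD.
move: E; rewrite /lookup.
have : (x, e) \in [seq d <- D | d.1 == x] by rewrite mem_filter eqxx.
by case: [seq d <- D | d.1 == x].
Qed.

Lemma eval_env_ext (rho rho' : V -> vals) (mu : valuation R) (e : expr S R V) :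
  {in evars e, rho =1 rho'} -> eval_env rho mu e = eval_env rho' mu e.
Proof.
elim: e => [n|[r|v]|o e1 IH1|o e1 IH1 e2 IH2
           |e1 IH1 e2 IH2 e3 IH3|e1 IH1 e2 IH2 e3 IH3] //= H.
- by apply: H; rewrite inE.
- by rewrite IH1.
- by rewrite IH1 ?IH2 // => x xe; apply: H; rewrite !inE xe ?orbT.
- by rewrite IH1 ?IH2 ?IH3 // => x xe; apply: H; rewrite !inE xe ?orbT.
- by rewrite IH1 ?IH2 ?IH3 // => x xe; apply: H; rewrite !inE xe ?orbT.
Qed.

Let down : rel V := fun v w => wire_dep C w v.

Lemma wire_val_stable mu n m v (p : seq V) :
  path down v p -> uniq (v :: p) -> {subset p <= wires C} ->
  #|` wires C| <= n + size p -> #|` wires C| <= m + size p ->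
  wire_val C mu n v = wire_val C mu m v.
Proof.
case: wfC => _ _ acyc _ _.
have full q w : uniq (w :: q) -> {subset q <= wires C} ->
    #|` wires C| <= size q -> lookup (wiredefs C) w = None.
  move=> uq qs sq; case E: (lookup _ w) => [e|//].
  have wC : w \in wires C by apply/imfsetP; exists (w, e) => //; exact: lookup_mem.
  suff : size (w :: q) <= #|` wires C| by rewrite /= ltnNge sq.
  by apply: uniq_leq_size => // x; rewrite inE => /orP[/eqP->|/qs].
elim: n m v p => [|n IH] [|m] v p //= pp up ps np mp.
- by rewrite (full p).
- by rewrite (full p).
case E: (lookup _ v) => [e|//].
apply: eval_env_ext => w we.
have vw : wire_dep C v w.
  by apply/existsP; exists [` lookup_mem E]; rewrite /= eqxx.
have vC : v \in wires C by apply/imfsetP; exists (v, e) => //; exact: lookup_mem.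
apply: (IH m w (v :: p)) => //=; last 3 first.
- by move=> x; rewrite inE => /orP[/eqP->|/ps].
- by rewrite addnS -addSn.
- by rewrite addnS -addSn.
- by rewrite /down vw.
rewrite -/(uniq (v :: p)); apply/andP; split; last exact: up.
apply/negP => wp.
have [p1 [p2 [wl Ep]]] : exists p1 p2, w = last v p1 /\ p = p1 ++ p2 :> seq V.
  move: wp; rewrite inE => /orP[/eqP->|wp]; first by exists [::], p.
  case/splitPr: wp => p1 p2; exists (rcons p1 w), p2.
  by rewrite last_rcons cat_rcons.
move: pp; rewrite Ep cat_path => /andP[pp1 _].
suff /acyc : cycle (wire_dep C) (w :: rev (belast v p1)) by [].
rewrite /= rcons_path wl rev_path pp1 /=.
case: p1 wl {Ep pp1} => [|a s] /= wl; first by rewrite -{2}wl.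
by rewrite rev_cons last_rcons -wl.
Qed.

Lemma eval_wire mu v e :
  (v, e) \in wiredefs C -> eval C mu (Id (inr v)) = eval C mu e.
Proof.
case: (wfC) => _ fW _ _ _ vW; rewrite {1}/eval /=.
rewrite (@wire_val_stable mu _ #|` wires C|.+1 v [::]) ?addn0 //=.
by rewrite (mem_lookup fW vW).
Qed.

End EvalWire.

(* Main.v *)
(** In the stuttering product, a component advances past a retirement only when
    the other one does, so along any product run both components have the same
    number of past retirements.  Two components retiring simultaneously are
    thus at retirements of equal rank, and equality of the filtered leakage
    traces makes the contract assumption hold at every step of the product run.
    The learned predicates then hold at every step by induction, hence so does
    the equivalence of the retirement predicates: the product never stutters,
    its components are the two plain runs in lockstep, and the attacker's
    observations agree at every step. *)

Require Import Defs.
From mathcomp Require Import all_boot finmap boolp classical_sets.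

Set Implicit Arguments.
Unset Strict Implicit.
Unset Printing Implicit Defensive.

Local Open Scope fset_scope.

(** * Looking up the binding of a register or wire *)

Section Lookup.
Variables (S : operators) (R V K : choiceType).
Implicit Types D : {fset K * expr S R V}.

Lemma lookup_None D x :
  (x \notin [fset d.1 | d in D]) = (lookup D x == None).
Proof.
case E: (lookup D x) => [e|]; apply/idP/idP => //.
  by apply/imfsetP; exists (x, e) => //; apply: lookup_mem.
apply/imfsetP => -[d dD xd]; move: E; rewrite /lookup.
have : d \in [seq d <- D | d.1 == x] by rewrite mem_filter xd eqxx.
by case: [seq d <- D | d.1 == x].
Qed.

Lemma lookup_fsetUl D D' x : functional (D `|` D') ->
  x \in [fset d.1 | d in D] -> lookup (D `|` D') x = lookup D x.
Proof.
move=> fD; case E: (lookup D x) => [e|].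
  by move=> _; apply: mem_lookup => //; rewrite inE (lookup_mem E).
by move/eqP: E; rewrite -lookup_None => /negPf ->.
Qed.

End Lookup.

(** * Evaluation and runs under composition with a monitor *)

Section Circuits.
Variables (S : operators) (R V : choiceType).
Implicit Types (C M : circuit S R V) (e : expr S R V) (mu : valuation R).
Implicit Type F : formula S R V.

Lemma eval_wire_free C C' mu e :
  evars e = fset0 -> eval C mu e = eval C' mu e.
Proof. by move=> e0; apply: eval_env_ext => v; rewrite e0 inE. Qed.

(** Acyclicity, through [wire_val_stable] on the empty chain. It lets evaluations be compared
    between circuits with different numbers of wires, hence different fuel. *)
Lemma wire_val_fuel C mu n v : well_formed C -> #|` wires C| <= n ->
  wire_val C mu n v = wire_val C mu #|` wires C| v.
Proof.
by move=> wfC Cn; apply: (@wire_val_stable _ _ _ _ wfC _ _ _ _ [::]) => //=;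
  rewrite addn0.
Qed.

Lemma rhs_assign C r e : lookup (assigns C) r = Some e -> e \in rhs C.
Proof.
move/lookup_mem => h; rewrite inE; apply/orP; left.
by apply/imfsetP; exists (r, e).
Qed.

Lemma rhs_wire C v e : lookup (wiredefs C) v = Some e -> e \in rhs C.
Proof.
move/lookup_mem => h; rewrite inE; apply/orP; right.
by apply/imfsetP; exists (v, e).
Qed.

Lemma mem_rhs_lookup C e : well_formed C -> e \in rhs C ->
  (exists r, lookup (assigns C) r = Some e) \/
  (exists v, lookup (wiredefs C) v = Some e).
Proof.
case=> fA fW _ _ _; rewrite inE => /orP[] /imfsetP [[x f] /= xf ->].
  by left; exists x; apply: mem_lookup.
by right; exists x; apply: mem_lookup.
Qed.

(** Starting from wires of [C], only wires of [C] are ever reached, and the monitor leaves their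
    definitions unchanged; the composition has at least as much fuel. *)
Lemma eval_compose C M mu e : well_formed C -> well_formed (compose M C) ->
  evars e `<=` wires C -> eval (compose M C) mu e = eval C mu e.
Proof.
move=> wfC [_ fW _ _ _] eC; case: (wfC) => _ _ _ _ usedC.
have wE n v : v \in wires C ->
    wire_val (compose M C) mu n v = wire_val C mu n v.
  elim: n v => [//|n IH] v vC /=; rewrite lookup_fsetUl //.
  case E: (lookup _ v) => [f|//]; apply: eval_env_ext => w wf.
  by apply: IH; apply: (fsubsetP (usedC _ (rhs_wire E))).
have le : #|` wires C| <= #|` wires (compose M C)|.
  apply: fsubset_leq_card; apply/fsubsetP => v /imfsetP[d dC ->].
  by apply/imfsetP; exists d => //=; rewrite inE dC.
apply: eval_env_ext => v ve; have vC := fsubsetP eC _ ve.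
by rewrite wE // wire_val_fuel.
Qed.

Lemma run_compose C M mu n : well_formed C -> well_formed (compose M C) ->
  assigns M = fset0 -> run (compose M C) mu n = run C mu n.
Proof.
move=> wfC wfM M0; rewrite /run; congr iter; apply/funext => nu.
apply/funext => r; rewrite /step /= M0 fsetU0.
case E: (lookup _ r) => [e|//]; apply: eval_compose => //.
by case: wfC => _ _ _ _; apply; apply: rhs_assign E.
Qed.

Lemma run_states C mu n : states C mu -> states C (run C mu n).
Proof.
move=> mu0; elim: n => //= n IH r rC; rewrite /step.
case E: (lookup _ r) => [e|]; last exact: IH.
suff : r \in write C by move: rC; rewrite inE => /norP[_ /negPf ->].
by apply/imfsetP; exists (r, e) => //; apply: lookup_mem.
Qed.

(** * Temporal formulas along a run *)

Lemma sat_at_run C mu i j F :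
  sat_at C (run C mu i) j F = sat_at C mu (j + i) F.
Proof.
have runD k : run C (run C mu i) k = run C mu (k + i) by rewrite /run iterD.
elim: F j => [|e|P|F IH|F IH G IG|F IH G IG|F IH G IG|F IH G IG|F IH|k F IH|F IH]
  j //=; rewrite ?runD ?IH ?IG //.
- by apply/propext; split=> h l /h; rewrite IH addnAC.
- by apply/propext; split=> h l; move: (h l); rewrite IH addnAC.
Qed.

Lemma sat_run C mu i F : sat C (run C mu i) F = sat_at C mu i F.
Proof. by rewrite /sat sat_at_run add0n. Qed.

Lemma sat_big_and (I : eqType) (s : seq I) (G : I -> formula S R V) C mu i :
  sat_at C mu i (\big[@FAnd S R V/FTrue]_(x <- s) G x) <->
  {in s, forall x, sat_at C mu i (G x)}.
Proof.
elim: s => [|x s IH]; first by rewrite big_nil; split.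
rewrite big_cons /=; split=> [[hx /IH hs] y|h].
  by rewrite inE => /orP[/eqP->|/hs].
split; first by apply: h; rewrite mem_head.
by apply/IH => y ys; apply: h; rewrite inE ys orbT.
Qed.

Lemma sat_conj_preds (CI : {fset expr S R V}) C mu i :
  sat_at C mu i (conj_preds CI) <->
  {in CI, forall psi, sat_at C mu i (FPred psi)}.
Proof. exact: sat_big_and. Qed.

(** * Correctness of invariant learning *)

Lemma base_loop_valid C F G b (CI CI' : {fset expr S R V}) :
  base_loop C F G b CI CI' -> valid C (Psi_base F G b CI').
Proof. by elim. Qed.

(** Each refinement filters the candidates, so what the base case established still covers the
    surviving ones. *)
Lemma inductive_loop_valid C G b (CI LI : {fset expr S R V}) :
  inductive_loop C G b CI LI ->
  LI `<=` CI /\ valid C (Psi_inductive G b LI).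
Proof.
elim=> [CI1 h|CI1 CI2 mu _ _ _ [sub h]]; first by split.
split=> //; apply: fsubset_trans sub _.
by apply/fsubsetP => x; rewrite !inE => /andP[].
Qed.

(** Induction along the run; [G] at every step supplies the lookahead hypothesis of both the base
    and the inductive formula. *)
Lemma learn_inv_sound C F G b (CI LI : {fset expr S R V}) mu :
  learn_inv C F G b CI LI -> states C mu -> sat C mu F ->
  (forall i, sat_at C mu i G) -> forall i, sat_at C mu i (conj_preds LI).
Proof.
case=> CI' /base_loop_valid base /inductive_loop_valid[sub ind] muC muF muG.
elim=> [|i IH].
  apply/sat_conj_preds => psi psiLI.
  have /sat_conj_preds : sat C mu (conj_preds CI').
    by apply: (base _ muC); split=> // j _; apply: muG.
  by apply; apply: (fsubsetP sub).
(* The [i]-th state of the run is taken as a new starting state, and [sat_run] shifts the conclusion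
   back. *)
have := ind _ (run_states i muC); rewrite sat_run; apply.
by split=> // j _; apply: muG.
Qed.

(** * Ranks of retirements and filtered traces *)

Lemma nth_hit_inj C phi mu n i j :
  nth_hit C phi mu n i -> nth_hit C phi mu n j -> i = j.
Proof.
wlog ij : i j / i <= j => [wl hi hj|].
  by case/orP: (leq_total i j) => [/wl|/wl h]; [apply | apply/esym/h].
case/andP=> hi /eqP ci /andP[_ /eqP cj]; apply/eqP.
rewrite eqn_leq ij leqNgt; apply/negP => lt.
suff : n < n by rewrite ltnn.
(* The first [i.+1] steps already contain [n.+1] hits, the last one at [i], whereas the first [j]
   steps contain only [n]. *)
rewrite -{2}cj -(subnKC lt) iotaD count_cat -addn1 -[X in X <= _]addn0.
rewrite leq_add // -[i.+1]addn1 iotaD count_cat ci /= add0n hi.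
by rewrite !addn0.
Qed.

Lemma filtered_trace_hit C phi mu n i : nth_hit C phi mu n i ->
  filtered_trace C phi mu n = Some (trace C mu i).
Proof.
move=> hi; rewrite /filtered_trace; case: pselect => [ex|]; last by case; exists i.
by case: ex_minnP => j hj _; rewrite (nth_hit_inj hi hj).
Qed.

(** Links equality of trace entries with the output-wise equalities of [psi_equiv_monitor]. *)
Lemma observe_eqP C mu mu' : observe C mu = observe C mu' <->
  {in outputs C, forall o, eval C mu (Id o) = eval C mu' (Id o)}.
Proof.
split=> [h o oC|h].
  by move/fmapP/(_ o): h; rewrite /observe !in_fnd !ffunE => -[].
by apply/fmapP => o; rewrite /observe; case: fndP => oC;
  [rewrite !in_fnd !ffunE /= h | rewrite not_fnd].
Qed.

End Circuits.

(** * The stuttering product and its two components *)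

Section StutterProduct.
Variables (S : operators) (R V : choiceType) (C : circuit S R V).
Variable phi : expr S R V.
Hypothesis wfC : well_formed C.
Implicit Type mu : valuation (R * bool)%type.

Let P := stutter_product phi C.

(** A general [g] covers both the assignments, which get a stuttering guard, and the wires, which
    are merely copied. *)
Lemma lookup_copies (K : choiceType) (D : {fset K * expr S R V})
    (g : K -> bool -> expr S R V -> expr S (R * bool)%type (V * bool)%type) x k :
  functional D ->
  lookup [fset ((d.1, l), g d.1 l d.2) | d in D, l in [fset false; true]] (x, k)
  = omap (g x k) (lookup D x).
Proof.
move=> fD; set D' := imfset2 _ _ _ _.
have fD' : functional D'.
  move=> [y l] e1 e2 /imfset2P[[y1 f1] /= h1 [l1 _ [-> -> ->]]].
  by move=> /imfset2P[[y2 f2] /= h2 [l2 _ [eqy -> ->]]]; subst y2; rewrite (fD _ _ _ h1 h2).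
case E: (lookup D x) => [e|] /=.
  apply: mem_lookup => //; apply/imfset2P; exists (x, e); first exact: lookup_mem.
  by exists k => //; rewrite !inE; case: k.
case E': (lookup D' _) => [e|//]; move/lookup_mem: E'.
move=> /imfset2P[[y f] /= yD [l _ [xy _ _]]]; subst y.
by rewrite (mem_lookup fD yD) in E.
Qed.

Lemma lookup_assigns_product r k :
  lookup (assigns P) (r, k) =
  omap (fun e => If (EAnd (copy k phi) (ENot (copy (~~ k) phi)))
                    (Id (inl (r, k))) (copy k e)) (lookup (assigns C) r).
Proof.
case: (wfC) => fA _ _ _ _.
exact: (lookup_copies (fun r k e => If (EAnd (copy k phi) (ENot (copy (~~ k) phi)))
                    (Id (inl (r, k))) (copy k e)) _ _ fA).
Qed.

Lemma lookup_wires_product v k :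
  lookup (wiredefs P) (v, k) = omap (copy k) (lookup (wiredefs C) v).
Proof.
case: (wfC) => _ fW _ _ _.
exact: (lookup_copies (fun _ => @copy S R V) _ _ fW).
Qed.

Lemma eval_env_copy rho mu k (e : expr S R V) :
  eval_env rho mu (copy k e)
  = eval_env (fun v => rho (v, k)) (component k mu) e.
Proof.
elim: e => [n|[r|v]|o e1 IH1|o e1 IH1 e2 IH2
           |e1 IH1 e2 IH2 e3 IH3|e1 IH1 e2 IH2 e3 IH3] //=;
  by rewrite ?IH1 ?IH2 ?IH3.
Qed.

Lemma eval_copy mu k (e : expr S R V) :
  eval P mu (copy k e) = eval C (component k mu) e.
Proof.
rewrite /eval eval_env_copy.
have wE n v : wire_val P mu n (v, k) = wire_val C (component k mu) n v.
  elim: n v => //= n IH v; rewrite lookup_wires_product.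
  case: (lookup _ v) => //= f; rewrite eval_env_copy.
  by apply: eval_env_ext => w _; apply: IH.
have le : #|` wires C| <= #|` wires P|.
  (* The first copies alone embed the wires of [C], so the fuel of the product suffices for [C]. *)
  have inj : {in wires C &, injective (fun v => (v, false))} by move=> v w _ _ [].
  rewrite -(card_in_imfset imfset_key inj); apply: fsubset_leq_card.
  apply/fsubsetP => _ /imfsetP[v /= vC ->]; apply: contraT.
  rewrite /wires lookup_None lookup_wires_product.
  case E: (lookup _ v) => //; move/eqP: E; rewrite -lookup_None.
  by rewrite -/(wires C) vC.
by apply: eval_env_ext => v _; rewrite wE wire_val_fuel.
Qed.

(** The guard does not depend on the assigned register, so a component stutters or steps as a
    whole. *)
Lemma component_step mu k :
  component k (step P mu) =
  if holds C (component k mu) phi && ~~ holds C (component (~~ k) mu) phi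
  then component k mu else step C (component k mu).
Proof.
apply/funext => r; rewrite /component {1}/step lookup_assigns_product.
case E: (lookup _ r) => [e|] /=; last by case: ifP => // _; rewrite /step E.
rewrite /eval /= -!/(eval _ _ _) !eval_copy -!/(holds _ _ _).
by case: (holds C (component k mu) phi); case: (holds C (component (~~ k) mu) phi);
  rewrite /= /step ?E.
Qed.

(** Every register of [C] has its copies in the product: a written one through its own assignment, a
    read one through the copied right-hand side. *)
Lemma states_product mu :
  states C (component false mu) -> states C (component true mu) -> states P mu.
Proof.
move=> s0 s1 [r k] rP.
suff rC : r \notin vars C by case: k rP => _; [apply: s1 | apply: s0].
apply: contra rP; rewrite inE => /orP[|rC]; last first.
  rewrite inE; apply/orP; right; apply: contraLR rC.
  by rewrite /write !lookup_None lookup_assigns_product; case: (lookup _ r).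
have rcopy (f : expr S R V) : r \in eregs f -> (r, k) \in eregs (copy k f).
  elim: f => [n|[s|v]|o e1 IH1|o e1 IH1 e2 IH2
           |e1 IH1 e2 IH2 e3 IH3|e1 IH1 e2 IH2 e3 IH3] //=.
  - by rewrite !inE => /eqP->.
  - by rewrite !inE => /orP[/IH1->|/IH2->]; rewrite ?orbT.
  - by rewrite !inE => /orP[/orP[/IH1->|/IH2->]|/IH3->]; rewrite ?orbT.
  - by rewrite !inE => /orP[/orP[/IH1->|/IH2->]|/IH3->]; rewrite ?orbT.
case/bigfcupP => e /andP[eC _] re.
rewrite inE; apply/orP; left.
have [[s E]|[v E]] := mem_rhs_lookup wfC eC.
- have := lookup_assigns_product s k; rewrite E => /rhs_assign fP.
  apply/bigfcupP; eexists; first by apply/andP; split; first exact: fP.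
  by rewrite /= !inE (rcopy e) ?orbT.
- have := lookup_wires_product v k; rewrite E => /rhs_wire fP.
  by apply/bigfcupP; eexists; [apply/andP; split; first exact: fP | apply: rcopy].
Qed.

(** The positions [i] and [j] may drift apart, but a component that moves alone leaves a
    non-retirement, so the counts stay equal. *)
Lemma run_product_rank mu n : exists i j,
  [/\ component false (run P mu n) = run C (component false mu) i,
      component true (run P mu n) = run C (component true mu) j
    & count (fun l => holds C (run C (component false mu) l) phi) (iota 0 i)
      = count (fun l => holds C (run C (component true mu) l) phi) (iota 0 j)].
Proof.
elim: n => [|n [i [j [Ei Ej Ec]]]]; first by exists 0, 0.
have cS nu l : count (fun l => holds C (run C nu l) phi) (iota 0 l.+1)
    = (count (fun l => holds C (run C nu l) phi) (iota 0 l)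
       + holds C (run C nu l) phi)%N.
  by rewrite -[l.+1]addn1 iotaD count_cat /= addn0.
rewrite /= !component_step /= Ei Ej.
case h0: (holds C (run C (component false mu) i) phi);
  case h1: (holds C (run C (component true mu) j) phi) => /=.
- by exists i.+1, j.+1; rewrite !cS h0 h1 Ec.
- by exists i, j.+1; rewrite !cS h1 Ec addn0.
- by exists i.+1, j; rewrite !cS h0 -Ec addn0.
- by exists i.+1, j.+1; rewrite !cS h0 h1 Ec.
Qed.

Lemma run_product_lockstep mu n :
  (forall i, holds C (component false (run P mu i)) phi
           = holds C (component true (run P mu i)) phi) ->
  forall k, component k (run P mu n) = run C (component k mu) n.
Proof.
move=> h; elim: n => // n IH k.
(* The guard becomes [x && ~~ x], so neither component stutters. *)
by rewrite /= component_step -IH; case: k; rewrite /= h andbN.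
Qed.

End StutterProduct.

(** * From a successful verification to contract satisfaction *)

Theorem theorem2 (S : operators) (R V : choiceType)
    (ISA : architecture S R V) (Impl : microarchitecture ISA)
    (LM Atk : circuit S R V) (phi : expr S R V) (b : nat)
    (CI : {fset expr S (R * bool)%type (V * bool)%type})
    (hLM : leakage_monitor Impl LM) (hAtk : attacker Impl Atk)
    (hphi : retirement_predicate Impl phi) (hb : 0 < b)
    (hCI : forall psi, psi \in CI ->
       predicate_over (stutter_product phi Impl) psi)
    (hverify : verify Impl LM Atk phi b CI true) :
  contract_sat Impl phi LM Atk.
Proof.
move=> mu mu' imu imu' equ ftr.
have wfI := impl_well_formed Impl.
case: hphi => _ phi0.
case: hLM => _ [[_ _ _ wfLM] _ LM0].
case: hAtk => -[_ _ _ wfAtk] _ Atk0.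
case: hverify => LI hLI [/(_ isT) hval _].
pose P := stutter_product phi Impl.
pose nu : valuation (R * bool)%type := fun x => if x.2 then mu' x.1 else mu x.1.
have nuP : states P nu.
  by apply: states_product => //; apply: impl_init_states.
have holds_copy k n : holds P (run P nu n) (copy k phi)
    = holds Impl (component k (run P nu n)) phi by rewrite /holds eval_copy.
have assumption n : sat_at P nu n (Phi_ctr_equiv Impl LM phi).
  case=> /=; rewrite !holds_copy => h0 h1; apply/sat_big_and => /=.
  have [i [j [Ei Ej Ec]]] := run_product_rank phi wfI nu n.
  rewrite Ei Ej in h0 h1 *.
  (* A retirement's rank is the number of earlier ones. The monitor affects neither the run nor
     [phi], which reads no wire. *)
  have hitE m l : nth_hit (compose LM Impl) phi m
      (count (fun l => holds Impl (run Impl m l) phi) (iota 0 l)) l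
      = holds Impl (run Impl m l) phi.
    have hE l' : holds (compose LM Impl) (run (compose LM Impl) m l') phi
        = holds Impl (run Impl m l') phi.
      by rewrite run_compose // /holds (eval_wire_free _ Impl).
    by rewrite /nth_hit hE (eq_count hE) eqxx andbT.
  (* Both steps thus have the same rank [c], so entry [c] of the equal filtered traces compares
     their observations. *)
  move: (hitE mu i) (hitE mu' j); rewrite -Ec h0 h1.
  move: (count _ _) => c hit_i hit_j.
  have := congr1 (fun t => t c) ftr.
  rewrite /= (filtered_trace_hit hit_i) (filtered_trace_hit hit_j).
  by move/Some_inj; rewrite /trace !run_compose // => /observe_eqP.
have init : sat P nu (Phi_initial Impl).
  by split; [|split=> //; apply/sat_big_and => x /= /equ].
(* The checked formula is valid from all states, in particular from each state of the product
   run. *)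
have concl n := hval _ (run_states n nuP).
have inv := learn_inv_sound hLI nuP init assumption.
have {}concl n : sat_at P nu n (psi_equiv_monitor Impl Atk) /\
    holds Impl (component false (run P nu n)) phi
    = holds Impl (component true (run P nu n)) phi.
  have := concl n; rewrite sat_run => /(_ (inv n)) [hA /= [h01 h10]].
  by split=> //; apply/idP/idP; rewrite -!holds_copy.
apply/funext => n; rewrite /trace !run_compose //.
(* Lockstep turns attacker equivalence on the product into equality of observations on the plain
   runs. *)
have lock := run_product_lockstep wfI n (fun i => (concl i).2).
rewrite -[run Impl mu n](lock false) -[run Impl mu' n](lock true).
by apply/observe_eqP; case: (concl n) => /sat_big_and.
Qed.
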